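(* Let $\mathcal H$ be a real Hilbert space, $A:\mathcal H\rightrightarrows\mathcal H$ a maximal monotone operator, $\theta>0$, and suppose $A^{-1}(0)\ne\emptyset$. Given $x_0\notin A^{-1}(0)$, let $(x,\lambda):[0,+\infty[\to\mathcal H\times\mathbb R_{++}$ be the unique global solution of the Cauchy problem $$\begin{cases}\dot x(t)+x(t)-(I+\lambda(t)A)^{-1}x(t)=0,\quad \lambda(t)>0,\\ \lambda(t)\,\|(I+\lambda(t)A)^{-1}x(t)-x(t)\|=\theta,\\ x(0)=x_0.\end{cases}$$ Let $d_0=d(x_0,A^{-1}(0))$ be the distance from $x_0$ to $A^{-1}(0)$. Then: i) for all $t>0$, $\|\dot x(t)\|=\|x(t)-J_{\lambda(t)}x(t)\|\le d_0/\sqrt{2t}$; hence $\lim_{t\to+\infty}\|\dot x(t)\|=0$; ii) for all $t>0$, $\lambda(t)\ge\theta\sqrt{2t}/d_0$; hence $\lim_{t\to+\infty}\lambda(t)=+\infty$; iii) $x(t)$ converges weakly, as $t\to+\infty$, to some $x_\infty\in A^{-1}(0)$. Moreover, for any $z\in A^{-1}(0)$, $t\mapsto\|x(t)-z\|$ is decreasing.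
   Context: $A^{-1}(0)=\{x\in\mathcal H:0\in Ax\}$. For $\lambda>0$, $J_\lambda=(I+\lambda A)^{-1}$ is the resolvent of $A$ of index $\lambda$. Existence and uniqueness of the global solution $(x,\lambda)$ (with $x$ of class $\mathscr C^1$ and $\lambda$ locally Lipschitz continuous) holds for every $x_0\notin A^{-1}(0)$. *)

(* Defs.v *)
From mathcomp Require Export all_boot all_order all_algebra sesquilinear.
From mathcomp Require Export all_classical all_reals all_analysis.
Export Order.TTheory GRing.Theory Num.Theory.
Export numFieldNormedType.Exports.

Set Implicit Arguments.
Unset Strict Implicit.
Unset Printing Implicit Defensive.

Local Open Scope classical_set_scope.
Local Open Scope ring_scope.

(* [{dot H for idfun}] only asks for a positive definite symmetric bilinear
   form; this condition ties it to the norm of [H], so that a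
   [completeNormedModType] with such a form is a real Hilbert space. *)
Definition induces_norm (R : realType) (H : normedModType R)
    (dot : {dot H for idfun}) : Prop :=
  forall u : H, dot u u = `|u| ^+ 2.

Section SetValuedOperators.
Variables (R : realType) (H : completeNormedModType R).
Implicit Types A B : H -> set H.

Definition monotone_op (dot : H -> H -> R) A : Prop :=
  forall x y u v, A x u -> A y v -> 0 <= dot (x - y) (u - v).

Definition maximal_monotone (dot : H -> H -> R) A : Prop :=
  monotone_op dot A /\
  forall B, monotone_op dot B -> (forall x, A x `<=` B x) -> B = A.

Definition inverse_op A : H -> set H := fun y => [set x | A x y].

Definition id_plus_scale (l : R) A : H -> set H :=
  fun x => [set x + l *: u | u in A x].

Definition zeros A : set H := inverse_op A 0.

(* For [A] maximal monotone and [0 < l], the set [(I + l A)^-1 x] is a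
   singleton (Minty), so that [get] returns its unique element. *)
Definition resolvent A (l : R) (x : H) : H :=
  get (inverse_op (id_plus_scale l A) x).

Definition dist (x : H) (S : set H) : R := inf [set `|x - z| | z in S].

End SetValuedOperators.

Section DerivativeWithin.
Variables (R : realType) (H : completeNormedModType R).
Implicit Types (D : set R) (f : R -> H).

(* Difference quotients of [f] at [t] along points of [D] only: this is the
   usual derivative in the interior of [D], and the right derivative at [0]
   when [D = `[0, +oo[]. *)
Definition derivable_within D f (t : R) : Prop :=
  cvg ((s - t)^-1 *: (f s - f t) @[s --> within D t^']).

Definition derive_within D f (t : R) : H :=
  lim ((s - t)^-1 *: (f s - f t) @[s --> within D t^']).

Definition C1_on D f : Prop :=
  (forall t, D t -> derivable_within D f t) /\
  {within D, continuous (derive_within D f)}.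

Definition locally_lipschitz_on D (g : R -> R) : Prop :=
  forall t, D t -> exists2 U, nbhs t U & [lipschitz g s | s in U `&` D].

(* Weak convergence in a Hilbert space, tested against inner products. *)
Definition weakly_cvg_pinfty (dot : H -> H -> R) f (l : H) : Prop :=
  forall y, dot (f t) y @[t --> +oo] --> dot l y.

End DerivativeWithin.

Definition half_line (R : realType) : set R := `[0, +oo[.

(* The functions are total on [R]; only their values on [[0, +oo[] matter. *)
Record global_solution (R : realType) (H : completeNormedModType R)
    (A : H -> set H) (theta : R) (x0 : H) (x : R -> H) (lambda : R -> R)
    : Prop := GlobalSolution {
  gs_C1 : C1_on (@half_line R) x;
  gs_lipschitz : locally_lipschitz_on (@half_line R) lambda;
  gs_ode : forall t, 0 <= t ->
    derive_within (@half_line R) x t + x t - resolvent A (lambda t) (x t) = 0;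
  gs_pos : forall t, 0 <= t -> 0 < lambda t;
  gs_constraint : forall t, 0 <= t ->
    lambda t * `|resolvent A (lambda t) (x t) - x t| = theta;
  gs_init : x 0 = x0 }.

(* Main.v *)
Require Import Defs.
From mathcomp Require Import ring lra.

(** Put w = x - J x, where J is the resolvent of index lambda, so that w is
    minus the velocity.  The constraint lambda |w| = theta removes lambda
    from the problem: by Minty's theorem the resolvent is a genuine one, and
    its defining inclusion says that the pair (x - w, theta^-1 |w| w) lies in
    the graph of A at every time ([resolvent_graph]).

    The heart of the proof is that |w| is nonincreasing in time.  Write the
    monotonicity of A between two times t and t + h, with increments dx and
    dw and G = |w'| w' - |w| w, as <dx, G> >= <dw, G>.  The map u |-> |u| u is
    the gradient of |u|^3 / 3, hence <dw, G> >= 0, and quantitatively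
    |dw| <= 2 |dx| ([yosida_lipschitz]): w depends Lipschitz continuously on
    x, although it is not assumed differentiable.  Since dx = - h w + o(h),
    the inequality <dx, G> >= 0 says that <w + w', G>, which controls
    (|w'| - |w|) (|w| + |w'|)^2 / 2, is at most o(h); so the right upper Dini
    derivative of |w| is nonpositive ([norm_velocity_step],
    [norm_velocity_nonincreasing]).

    For a zero z of A, monotonicity between z and x - w gives
    <w, x - z> >= |w|^2, hence |x - z|^2 decreases at rate at least 2 |w|^2.
    Because |w| is nonincreasing, the rate on [s, t] is at least its value at
    t ([flow_dist_decay]).  This yields the strict decrease of |x - z| and,
    with s = 0, the bound 2 t |w t|^2 <= |x0 - z|^2; taking the infimum over
    z gives the rate for |w|, and the one for lambda = theta / |w| follows.

    Weak convergence is Opial's argument ([opial]).  Along any ultrafilter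
    finer than the neighbourhoods of +oo the bounded trajectory has a weak
    limit, provided by the Riesz representation of y |-> lim <x, y>.  That
    limit is a zero of A, because theta^-1 |w| w and w tend to 0 and the
    graph of a maximal monotone operator contains every pair monotonically
    related to it.  The convergence of all the distances |x - z| forces all
    these ultrafilter limits to coincide.

    Minty's theorem and the Riesz representation both rest on one
    minimization principle in H x H, [convex_opp_subgradient]. *)

Set Implicit Arguments.
Unset Strict Implicit.
Unset Printing Implicit Defensive.

Local Open Scope classical_set_scope.
Local Open Scope ring_scope.

(** * Hilbert space preliminaries *)

(** The form is handled as a function into [R] itself: the values of a
    [{dot H for idfun}] live in a type that is only convertible to [R], which
    hides the topology of [R] from unification. *)
Record inner_product (R : realType) (H : normedModType R) (dot : H -> H -> R)
    : Prop := InnerProduct {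
  ip_sym : forall u v, dot u v = dot v u;
  ip_add : forall u v w, dot (u + v) w = dot u w + dot v w;
  ip_scale : forall c u w, dot (c *: u) w = c * dot u w;
  ip_norm : forall u, dot u u = `|u| ^+ 2 }.

Lemma dot_form_inner_product (R : realType) (H : normedModType R)
    (dot : {dot H for idfun}) : induces_norm dot -> inner_product dot.
Proof.
move=> dot_norm; split => [u v|u v w|c u w|//].
- by rewrite hermC expr0 mul1r.
- exact: linearDl.
- exact: linearZl_LR.
Qed.

Section InnerProduct.
Variables (R : realType) (H : completeNormedModType R) (dot : H -> H -> R).
Hypothesis ip : inner_product dot.
Implicit Types (u v w : H) (c : R).

Lemma dotC u v : dot u v = dot v u. Proof. exact: ip_sym. Qed.

Lemma dotDl u v w : dot (u + v) w = dot u w + dot v w.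
Proof. exact: ip_add. Qed.

Lemma dotZl c u w : dot (c *: u) w = c * dot u w.
Proof. exact: ip_scale. Qed.

Lemma dot0l w : dot 0 w = 0.
Proof. by rewrite -[0 in LHS](scale0r 0) dotZl mul0r. Qed.

Lemma dotNl u w : dot (- u) w = - dot u w.
Proof. by rewrite -scaleN1r dotZl mulN1r. Qed.

Lemma dotDr u v w : dot u (v + w) = dot u v + dot u w.
Proof. by rewrite dotC dotDl !(dotC u). Qed.

Lemma dotNr u w : dot u (- w) = - dot u w.
Proof. by rewrite dotC dotNl (dotC u). Qed.

Lemma dotZr c u w : dot u (c *: w) = c * dot u w.
Proof. by rewrite dotC dotZl (dotC u). Qed.

Lemma dot_norm u : dot u u = `|u| ^+ 2.
Proof. exact: ip_norm. Qed.

Definition dotE := (dotDl, dotDr, dotNl, dotNr, dotZl, dotZr).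

Lemma dot_ge0 u : 0 <= dot u u.
Proof. by rewrite dot_norm exprn_ge0. Qed.

(** Cauchy-Schwarz is the square of the triangle inequality, which the norm of
    [H] satisfies by assumption. *)
Lemma dot_le_norm u v : dot u v <= `|u| * `|v|.
Proof.
have : `|u + v| ^+ 2 <= (`|u| + `|v|) ^+ 2.
  by rewrite lerXn2r ?nnegrE ?addr_ge0 // ler_normD.
by rewrite -dot_norm !dotE (dotC v u) !dot_norm; lra.
Qed.

Lemma normr_dot_le u v : `|dot u v| <= `|u| * `|v|.
Proof.
by rewrite ler_norml dot_le_norm andbT -(normrN u) lerNl -dotNl dot_le_norm.
Qed.

Lemma dot_continuousl v : continuous (dot ^~ v).
Proof.
move=> u; apply/cvgrPdist_le => e e0.
have d0 : 0 < e / (`|v| + 1) by rewrite divr_gt0 ?ltr_wpDl.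
have /cvgrPdist_le/(_ _ d0) : id @ u --> u by exact: cvg_id.
apply: filterS => w uw; rewrite -dotNl -dotDl (le_trans (normr_dot_le _ _))//.
rewrite -[leRHS](@mulfVK _ (`|v| + 1)) ?lt0r_neq0 ?ltr_wpDl//.
by apply: ler_pM => //; rewrite lerDl.
Qed.

Lemma cvg_dotl (T : Type) (F : set_system T) (FF : Filter F) (f : T -> H)
    (l v : H) : f @ F --> l -> dot (f t) v @[t --> F] --> dot l v.
Proof. by move=> fl; exact: cvg_comp fl (@dot_continuousl v l). Qed.

(** The shape in which the parallelogram identity makes a minimizing sequence
    Cauchy. *)
Lemma sqr_norm_cauchy_cvg (u : nat -> H) (K : R) :
  (forall n k, `|u n - u k| ^+ 2 <= K * (n.+1%:R^-1 + k.+1%:R^-1)) ->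
  cvgn u.
Proof.
move=> uK; apply: cauchy_cvg; apply: cauchy_exP => e e0.
have K0 : 0 < Num.max K 1 by rewrite lt_max ltr01 orbT.
have d0 : 0 < e ^+ 2 / Num.max K 1 / 2 by rewrite !divr_gt0 ?exprn_gt0.
have [N _ hN] := near_infty_natSinv_lt (PosNum d0).
exists (u N); exists N => // n Nn /=.
rewrite -ball_normE /= -(@ltr_pXn2r _ 2)// ?nnegrE ?(ltW e0)//.
apply: le_lt_trans (uK N n) _.
apply: (@le_lt_trans _ _ (Num.max K 1 * (N.+1%:R^-1 + n.+1%:R^-1))).
  by rewrite ler_wpM2r ?addr_ge0 ?invr_ge0// le_max lexx.
rewrite mulrC -ltr_pdivlMr//.
by rewrite [ltRHS]splitr ltrD//; [exact: (hN N (leqnn N)) | exact: (hN n Nn)].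
Qed.


(** * Minimization, Minty's theorem and Riesz representation *)

(** Think of [C] as the epigraph of a closed convex function F on H x H.  Then
    F + |.|^2 / 2 is strongly convex, so it attains its minimum, at (p, q)
    say, and the first order condition there is the conclusion: -(p, q) is a
    subgradient of F at (p, q).  Using the epigraph avoids infinite values
    of F. *)
Lemma convex_opp_subgradient (C : H -> H -> R -> Prop) :
  (forall (p q : nat -> H) (r : nat -> R) p' q' r',
     (forall n, C (p n) (q n) (r n)) -> p @ \oo --> p' -> q @ \oo --> q' ->
     r @ \oo --> r' -> C p' q' r') ->
  (forall p q r p' q' r' (a : R), C p q r -> C p' q' r' -> 0 < a < 1 ->
     C (p + a *: (p' - p)) (q + a *: (q' - q)) (r + a * (r' - r))) ->
  (exists p q r, C p q r) ->
  (exists m : R, forall p q r, C p q r -> m <= r + (`|p| ^+ 2 + `|q| ^+ 2) / 2) ->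
  exists p q r, C p q r /\
    forall p' q' r', C p' q' r' -> r - dot p (p' - p) - dot q (q' - q) <= r'.
Proof.
move=> Ccl Ccvx [p0 [q0 [r0 C0]]] [m0 Cm0].
pose pen (c : H * H * R) := c.2 + (`|c.1.1| ^+ 2 + `|c.1.2| ^+ 2) / 2.
pose S := [set c : H * H * R | C c.1.1 c.1.2 c.2].
have infE : has_inf (pen @` S).
  split; first by exists (pen (p0, q0, r0)); exists (p0, q0, r0).
  by exists m0 => _ [[[p q] r] /= Cpqr <-]; exact: Cm0.
pose m := inf (pen @` S).
have m_le p q r : C p q r -> m <= r + (`|p| ^+ 2 + `|q| ^+ 2) / 2.
  by move=> Cpqr; apply: ge_inf; [exact: infE.2|exists (p, q, r)].
have /choice[c cP] : forall n : nat,
    exists c : H * H * R, S c /\ pen c < m + n.+1%:R^-1.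
  move=> n; have [|_ [c Sc <-] cm] := @inf_adherent _ _ (n.+1%:R^-1) _ infE.
    by rewrite invr_gt0.
  by exists c.
pose p n := (c n).1.1; pose q n := (c n).1.2; pose r n := (c n).2.
have Cc n : C (p n) (q n) (r n) by have [] := cP n.
have cm n : r n + (`|p n| ^+ 2 + `|q n| ^+ 2) / 2 < m + n.+1%:R^-1.
  by have [] := cP n.
have par (u v : H) : `|u + 2^-1 *: (v - u)| ^+ 2
    = (`|u| ^+ 2 + `|v| ^+ 2) / 2 - `|u - v| ^+ 2 / 4.
  by rewrite -!dot_norm !dotE (dotC v u); field.
have cauchy n k : `|p n - p k| ^+ 2 + `|q n - q k| ^+ 2
    <= 4 * (n.+1%:R^-1 + k.+1%:R^-1).
  (* the midpoint of two points of C is at least at height m *)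
  have half : 0 < (2^-1 : R) < 1 by lra.
  have := m_le _ _ _ (Ccvx _ _ _ _ _ _ _ (Cc n) (Cc k) half).
  rewrite !par; have := cm n; have := cm k.
  by move: n.+1%:R^-1 k.+1%:R^-1 => en ek; lra.
have p_cvg : cvgn p.
  apply: (@sqr_norm_cauchy_cvg _ 4) => n k.
  by apply: le_trans (cauchy n k); rewrite lerDl exprn_ge0.
have q_cvg : cvgn q.
  apply: (@sqr_norm_cauchy_cvg _ 4) => n k.
  by apply: le_trans (cauchy n k); rewrite lerDr exprn_ge0.
pose P := limn p; pose Q := limn q.
have pen_cvg : pen (c n) @[n --> \oo] --> m.
  apply/cvgrPdist_le => e e0.
  have [N _ hN] := near_infty_natSinv_lt (PosNum e0).
  exists N => // n /hN /= nN; rewrite ler_norml.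
  have := m_le _ _ _ (Cc n); have [_] := cP n; rewrite /pen.
  by move: nN; rewrite /p /q /r; move: n.+1%:R^-1 => en; lra.
have norm2_cvg (u : nat -> H) : cvgn u ->
    `|u n| ^+ 2 @[n --> \oo] --> `|limn u| ^+ 2.
  by move=> ucvg; apply: cvgM; apply: cvg_norm.
pose r1 := m - (`|P| ^+ 2 + `|Q| ^+ 2) / 2.
have r_cvg : r n @[n --> \oo] --> r1.
  rewrite (_ : r = fun n => pen (c n) - (`|p n| ^+ 2 + `|q n| ^+ 2) / 2).
    apply: cvgB => //; apply: cvgMl; apply: cvgD; exact: norm2_cvg.
  by apply/funext => n; rewrite /pen /r addrK.
have CPQ : C P Q r1 by apply: Ccl r_cvg.
exists P, Q, r1; split => // p' q' s' C'.
rewrite leNgt; apply/negP => lt_s.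
pose B := s' - r1 + dot P (p' - P) + dot Q (q' - Q).
pose N := `|p' - P| ^+ 2 + `|q' - Q| ^+ 2.
have B0 : B < 0 by rewrite /B; lra.
have N0 : 0 <= N by rewrite addr_ge0 ?exprn_ge0.
(* the step at which the quadratic term is still dominated by the negative
   slope B *)
pose a := - B / (N + 1 - B).
have den0 : 0 < N + 1 - B by lra.
have a01 : 0 < a < 1 by rewrite divr_gt0 ?oppr_gt0// ltr_pdivrMr// mul1r; lra.
have := m_le _ _ _ (Ccvx _ _ _ _ _ _ a CPQ C' a01).
have expand (u v : H) : `|u + a *: v| ^+ 2
    = `|u| ^+ 2 + 2 * a * dot u v + a ^+ 2 * `|v| ^+ 2.
  by rewrite -!dot_norm !dotE (dotC v u); ring.
rewrite !expand => mB.
have aB : 0 <= a * (B + a * N / 2) by rewrite /B /N; move: mB; rewrite /r1; lra.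
have : 0 <= B + a * N / 2 by rewrite -(pmulr_rge0 _ (andP a01).1).
have aE : a * (N + 1 - B) = - B by rewrite /a mulfVK ?lt0r_neq0.
have a0 : 0 < a by case/andP: a01.
nra.
Qed.

(** Otherwise the pair (p, q) could be added to the graph of [A]. *)
Lemma maximal_monotone_related (A : H -> set H) p q :
  maximal_monotone dot A ->
  (forall u v, A u v -> 0 <= dot (p - u) (q - v)) -> A p q.
Proof.
move=> [Amon Amax] rel.
pose B u := A u `|` [set v | u = p /\ v = q].
have -> : A = B; last by right.
apply/esym/Amax => [|u v]; last by left.
move=> u u' v v' [Auv|[-> ->]] [Auv'|[-> ->]].
- exact: Amon.
- by rewrite dotC -opprB -(opprB p) dotNl dotNr opprK dotC rel.
- exact: rel.
- by rewrite !subrr dot0l.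
Qed.

(** Minimize with F the Fitzpatrick function of [B], the supremum over the
    graph of <y, v> + <u, z> - <u, v>.  Maximality gives F (y, z) >= <y, z>,
    with F (u, v) = <u, v> on the graph.  At the point (p, q) of
    [convex_opp_subgradient] the subgradient inequality then reads
    <- q - u, - p - v> >= |p + q|^2 for every (u, v) in the graph: so
    (- q, - p) belongs to the graph, and testing the inequality there gives
    p = - q. *)
Lemma minty_zero (B : H -> H -> Prop) :
  (forall u v u' v', B u v -> B u' v' -> 0 <= dot (u - u') (v - v')) ->
  (forall p q, (forall u v, B u v -> 0 <= dot (p - u) (q - v)) -> B p q) ->
  exists y, B y (- y).
Proof.
move=> Bmon Bmax.
have [u0 [v0 B0]] : exists u v, B u v.
  have [//|noB] := pselect (exists u v, B u v).
  by exists 0, 0; apply: Bmax => u v Buv; case: noB; exists u, v.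
pose C y z r := forall u v, B u v -> dot y v + dot u z - dot u v <= r.
have CB u v : B u v -> C u v (dot u v).
  move=> Buv u' v' Buv'; have := Bmon _ _ _ _ Buv Buv'.
  by rewrite !dotE; lra.
have C_ge y z r : C y z r -> dot y z <= r.
  move=> Cyzr; rewrite leNgt; apply/negP => ltr.
  have /Cyzr : B y z; last by lra.
  by apply: Bmax => u v /Cyzr; rewrite !dotE; lra.
have [|||| p [q [r [Cpqr min]]]] := @convex_opp_subgradient C.
- move=> p q r p' q' r' Cn pp' qq' rr' u v Buv.
  apply: ler_cvg_to rr' _; last first.
    by apply: nearW => n; exact: (Cn n _ _ Buv).
  apply: cvgB; last exact: cvg_cst.
  apply: cvgD; first exact: cvg_dotl.
  by rewrite dotC; under eq_fun do rewrite dotC; exact: cvg_dotl.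
- move=> p q r p' q' r' a Cpqr Cpqr' /andP[a0 a1] u v Buv.
  have := Cpqr _ _ Buv; have := Cpqr' _ _ Buv.
  by rewrite !dotE => le' le; nra.
- by exists u0, v0, (dot u0 v0); exact: CB.
- exists 0 => p q r /C_ge; have := dot_ge0 (p + q).
  by rewrite !dotE -!dot_norm (dotC q p); lra.
have key u v : B u v -> `|p + q| ^+ 2 <= dot (- q - u) (- p - v).
  move=> /CB/min; have := C_ge _ _ _ Cpqr.
  by rewrite -dot_norm !dotE (dotC q p) (dotC u p); lra.
have Bqp : B (- q) (- p).
  by apply: Bmax => u v /key; apply: le_trans; rewrite exprn_ge0.
have := key _ _ Bqp; rewrite subrr dot0l => pq0.
exists (- q); rewrite opprK; suff pq : - p = q by rewrite -{2}pq.
apply/eqP; rewrite eq_sym -addr_eq0 addrC -normr_eq0 -sqrf_eq0 eq_le pq0.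
exact: exprn_ge0.
Qed.

(** Minty's theorem: apply [minty_zero] to the operator l A - x. *)
Lemma minty (A : H -> set H) (l : R) x :
  maximal_monotone dot A -> 0 < l -> exists y, A y (l^-1 *: (x - y)).
Proof.
move=> maxA l0.
have [||y Ay] := @minty_zero (fun u v => A u (l^-1 *: (v + x))).
- move=> u v u' v' /maxA.1 mon /mon.
  by rewrite -scalerBr opprD addrACA subrr addr0 dotZr pmulr_rge0 ?invr_gt0.
- move=> p q rel; apply: maximal_monotone_related => // u w Auw.
  rewrite -(pmulr_rge0 _ l0) -dotZr scalerBr scalerA divff ?lt0r_neq0//.
  rewrite scale1r; have := rel u (l *: w - x).
  rewrite subrK scalerA mulVf ?lt0r_neq0// scale1r => /(_ Auw).
  by rewrite opprB addrA.
- by exists y; rewrite addrC.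
Qed.

(** The minimizer of - phi + |.|^2 / 2; the second factor of H x H is pinned
    to 0. *)
Lemma riesz_representation (phi : H -> R) (M : R) :
  (forall u v, phi (u + v) = phi u + phi v) ->
  (forall c u, phi (c *: u) = c * phi u) ->
  (forall u, phi u <= M * `|u|) ->
  exists p, forall u, phi u = dot p u.
Proof.
move=> phiD phiZ phiM.
have phiN u : phi (- u) = - phi u by rewrite -scaleN1r phiZ mulN1r.
pose C (p q : H) r := q = 0 /\ - phi p <= r.
have [|||| p [q [r [[q0 pr] min]]]] := @convex_opp_subgradient C.
- move=> p q r p' q' r' Cn pp' qq' rr'; split.
    have q0 : q = fun=> 0 by apply/funext => n; have [] := Cn n.
    by rewrite -(cvg_lim _ qq')// q0 lim_cst.
  have bound n : - phi p' - M * `|p n - p'| <= r n.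
    have := phiM (p n - p'); rewrite phiD phiN; have := (Cn n).2; lra.
  have lo : - phi p' - M * `|p n - p'| @[n --> \oo] --> - phi p'.
    rewrite -[X in _ --> X]subr0; apply: cvgB; first exact: cvg_cst.
    rewrite -[X in _ --> X](mulr0 M); apply: cvgMr.
    rewrite -(@normr0 _ H) -(subrr p'); apply: cvg_norm; apply: cvgB => //.
    exact: cvg_cst.
  by apply: ler_cvg_to lo rr' _; apply: nearW.
- move=> p q r p' q' r' a [-> pr] [-> pr'] /andP[a0 a1]; split.
    by rewrite subrr scaler0 addr0.
  by rewrite !(phiD, phiZ, phiN); nra.
- by exists 0, 0, (- phi 0); split.
- exists (- (M ^+ 2 / 2)) => p q r [-> pr]; rewrite normr0.
  by have := phiM p; have := sqr_ge0 (`|p| - M); nra.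
exists p.
have le_phi h : phi h <= dot p h.
  have : C (p + h) q (- phi (p + h)) by split.
  by move=> /min; rewrite phiD (addrC p) addrK q0 dot0l; lra.
move=> h; apply/eqP; rewrite eq_le le_phi/=.
by have := le_phi (- h); rewrite phiN dotNr lerN2.
Qed.

(** * Calculus on the half-line *)

(** The points t of [a, b] with f t <= f a + e (t - a) contain their supremum
    by continuity, and the Dini condition pushes them beyond any c < b. *)
Lemma dini_nonincreasing (f : R -> R) (a b : R) :
  a <= b -> {within `[a, b], continuous f} ->
  (forall t, a <= t < b -> forall e, 0 < e ->
     \forall s \near t^'+, f s - f t <= e * (s - t)) ->
  f b <= f a.
Proof.
move=> ab /subspace_continuousP fcont fdini.
apply/ler_addgt0Pr => e0 e0_gt0.
pose e := e0 / (b - a + 1).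
have e_gt0 : 0 < e by rewrite divr_gt0// ltr_wpDl ?subr_ge0.
suff : f b <= f a + e * (b - a).
  move=> /le_trans; apply; rewrite lerD2l /e mulrAC ler_pdivrMr; last by lra.
  nra.
pose S := [set t | a <= t <= b /\ f t <= f a + e * (t - a)].
have Sa : S a by split; rewrite ?lexx ?ab// subrr mulr0 addr0.
have supS : has_sup S by split; [exists a|exists b => t [/andP[]]].
pose c := sup S.
have ac : a <= c by apply: ub_le_sup => //; exact: supS.2.
have cb : c <= b by apply: ge_sup; [exists a|move=> t [/andP[]]].
have Sc : f c <= f a + e * (c - a).
  rewrite leNgt; apply/negP => fc.
  have : \forall s \near within `[a, b] (nbhs c), f a + e * (c - a) < f s.
    by apply: (cvgr_gt (f c)) => //; apply: fcont; rewrite /= in_itv /= ac.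
  move=> [d /= d0 dP].
  have [s [/andP[as_ sb] Ss] cs] := sup_adherent d0 supS.
  have sc : s <= c by apply: ub_le_sup; [exact: supS.2|split => //; exact/andP].
  have := dP s; rewrite /= ger0_norm ?subr_ge0// in_itv /= as_ sb.
  by rewrite -/c in cs; move=> /(_ _ isT); nra.
have [c_eq_b|c_neq_b] := eqVneq c b; first by rewrite -c_eq_b.
have c_lt_b : c < b by rewrite lt_neqAle c_neq_b.
have := fdini c; rewrite ac c_lt_b => /(_ isT e e_gt0) fc.
have [s [[cs sb] fs]] : exists s, (c < s /\ s < b) /\ f s - f c <= e * (s - c).
  have := @filter_ex _ (c^'+) _ _ (filterI (filterI (nbhs_right_gt c)
    (nbhs_right_lt c_lt_b)) fc).
  by move=> [s [[]]]; exists s.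
suff : s <= c by rewrite leNgt cs.
apply: ub_le_sup; [exact: supS.2|split; lra].
Qed.

Lemma derivable_within_expansion (D : set R) (f : R -> H) (t e : R) :
  derivable_within D f t -> 0 < e ->
  \forall s \near t, D s ->
    `|f s - f t - (s - t) *: derive_within D f t| <= e * `|s - t|.
Proof.
move=> /cvgrPdist_le/(_ e) df e0.
have dfe : \forall s \near t, s != t -> D s ->
    `|derive_within D f t - (s - t)^-1 *: (f s - f t)| <= e by exact: df e0.
apply: filterS dfe => s dfs Ds.
have [->|st] := eqVneq s t.
  by rewrite !subrr scale0r subr0 !normr0 mulr0.
have st0 : s - t != 0 by rewrite subr_eq0.
have -> : f s - f t = (s - t) *: ((s - t)^-1 *: (f s - f t)).
  by rewrite scalerA divff// scale1r.
by rewrite -scalerBr normrZ mulrC ler_wpM2r// distrC; apply: dfs.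
Qed.

Lemma derivable_within_continuous (D : set R) (f : R -> H) (t : R) :
  derivable_within D f t -> f @ within D (nbhs t) --> f t.
Proof.
move=> df; apply/cvgrPdist_le => e e0.
have := derivable_within_expansion df ltr01.
set v := derive_within D f t => exp.
have d0 : 0 < e / (1 + `|v|) by rewrite divr_gt0// ltr_pwDl.
have near_t : \forall s \near t, `|t - s| <= e / (1 + `|v|).
  by have /cvgrPdist_le/(_ _ d0) : id @ t --> t by exact: cvg_id.
change (\forall s \near t, D s -> `|f t - f s| <= e).
apply: filterS2 near_t exp => s st hs Ds.
rewrite mul1r in hs; rewrite distrC.
have -> : f s - f t = (f s - f t - (s - t) *: v) + (s - t) *: v by rewrite subrK.
rewrite (le_trans (ler_normD _ _))// normrZ.
have := hs Ds; move: st; rewrite distrC ler_pdivlMr ?ltr_pwDl//.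
lra.
Qed.

(** * Speed of the trajectory *)

(** The increment of u |-> |u| u, the gradient of |u|^3 / 3. *)
Definition cube_diff w w' := `|w'| *: w' - `|w| *: w.

Lemma dot_cube_diff w w' :
  dot (w' - w) (cube_diff w w')
    = (`|w| + `|w'|) / 2 * (`|w' - w| ^+ 2 + (`|w'| - `|w|) ^+ 2).
Proof.
rewrite /cube_diff -(dot_norm (w' - w)) !dotE (dotC w w') !dot_norm.
by field.
Qed.

Lemma norm_cube_diff w w' :
  `|cube_diff w w'| <= (`|w| + `|w'|) * `|w' - w|.
Proof.
have -> : cube_diff w w' = `|w'| *: (w' - w) + (`|w'| - `|w|) *: w.
  by rewrite /cube_diff scalerBr scalerBl addrA subrK.
rewrite (le_trans (ler_normD _ _))// !normrZ normr_id.
have := lerB_dist w' w; have := lerB_dist w w'; rewrite (distrC w w').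
have := normr_ge0 w; have := normr_ge0 w' => w0' w0 h1 h2.
have : `| `|w'| - `|w| | <= `|w' - w| by rewrite ler_norml; lra.
nra.
Qed.

(** Strong monotonicity of u |-> |u| u turns the monotonicity of the graph
    (u - w, |w| w) into Lipschitz dependence of w on u. *)
Lemma yosida_lipschitz u u' w w' :
  0 <= dot ((u' - w') - (u - w)) (cube_diff w w') ->
  `|w' - w| <= 2 * `|u' - u|.
Proof.
have -> : u' - w' - (u - w) = (u' - u) - (w' - w).
  by rewrite !opprD !opprK addrACA.
rewrite dotDl dotNl subr_ge0 dot_cube_diff => h.
have := le_trans h (dot_le_norm _ _) => {}h.
have key : (`|w| + `|w'|) / 2 * `|w' - w| ^+ 2 <=
    `|u' - u| * ((`|w| + `|w'|) * `|w' - w|).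
  apply: le_trans (le_trans h _).
    rewrite ler_wpM2l ?divr_ge0 ?addr_ge0// lerDl exprn_even_ge0//.
  by rewrite ler_wpM2l// norm_cube_diff.
have [->|ww'] := eqVneq w' w; first by rewrite subrr normr0 mulr_ge0.
have d0 : 0 < `|w' - w| by rewrite normr_gt0 subr_eq0.
have s0 : 0 < `|w| + `|w'|.
  by rewrite (lt_le_trans d0)// (addrC `|w|) ler_normB.
rewrite -(ler_pM2l (mulr_gt0 s0 d0)).
by lra.
Qed.

Lemma dot_sum_cube_diff w w' : `|w| <= `|w'| ->
  (`|w'| - `|w|) * (`|w| + `|w'|) ^+ 2 / 2 <= dot (w + w') (cube_diff w w').
Proof.
move=> ww'; rewrite /cube_diff !dotE (dotC w' w) !dot_norm.
have := dot_le_norm (- w) w'; rewrite dotNl normrN => cs.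
have ba : 0 <= `|w'| - `|w| by rewrite subr_ge0.
have h1 : 0 <= (`|w'| - `|w|) * (dot w w' + `|w| * `|w'|).
  by rewrite mulr_ge0//; lra.
have h2 : 0 <= (`|w'| - `|w|) * (`|w'| - `|w|) ^+ 2 by rewrite mulr_ge0 ?sqr_ge0.
lra.
Qed.

(** When u' = u - h w + o(h), the right-hand side is o(h) h by
    [yosida_lipschitz]; this is the differential inequality for |w| in finite
    difference form.  The vector w is replaced by the average of w and w',
    whose product with [cube_diff] is controlled by [dot_sum_cube_diff], at
    the cost of the term h |u' - u|. *)
Lemma norm_velocity_step u u' w w' (h : R) :
  0 < h -> w != 0 ->
  0 <= dot ((u' - w') - (u - w)) (cube_diff w w') ->
  (`|w'| - `|w|) * h * `|w|
    <= 4 * (`|u' - u + h *: w| + h * `|u' - u|) * (2 * `|u' - u|).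
Proof.
move=> h0 w0 mon.
have d_le := yosida_lipschitz mon.
have [w'w|ww'] := leP `|w'| `|w|.
  apply: (@le_trans _ _ 0); last by rewrite !mulr_ge0// addr_ge0// mulr_ge0// ltW.
  by rewrite -mulrA mulr_le0_ge0 ?subr_le0// mulr_ge0// ltW.
pose r := u' - u + h *: w; rewrite -/r.
have Dge0 : 0 <= dot (u' - u) (cube_diff w w').
  move: mon; have -> : u' - w' - (u - w) = (u' - u) - (w' - w).
    by rewrite !opprD !opprK addrACA.
  rewrite dotDl dotNl subr_ge0; apply: le_trans.
  by rewrite dot_cube_diff mulr_ge0// ?divr_ge0// addr_ge0// sqr_ge0.
have sum_le : h / 2 * dot (w + w') (cube_diff w w')
    <= dot (r + (h / 2) *: (w' - w)) (cube_diff w w').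
  move: Dge0; rewrite /r.
  move: (cube_diff w w') => G; rewrite !dotE; lra.
have s0 : 0 < `|w| + `|w'| by rewrite ltr_wpDr// normr_gt0.
have rhs : dot (r + (h / 2) *: (w' - w)) (cube_diff w w')
    <= (`|r| + h * `|u' - u|) * ((`|w| + `|w'|) * (2 * `|u' - u|)).
  apply: le_trans (dot_le_norm _ _) _; apply: ler_pM => //.
    rewrite (le_trans (ler_normD _ _))// lerD2l normrZ gtr0_norm ?divr_gt0//.
    by have := ler_wpM2l (ltW h0) d_le; lra.
  by apply: le_trans (norm_cube_diff _ _) _; rewrite ler_pM2l.
have lhs := dot_sum_cube_diff (ltW ww').
have : (`|w| + `|w'|) * (h * (`|w'| - `|w|) * (`|w| + `|w'|) / 4) <=
    (`|w| + `|w'|) * ((`|r| + h * `|u' - u|) * (2 * `|u' - u|)).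
  apply: le_trans (le_trans sum_le (le_trans rhs _)); last by lra.
  have := ler_wpM2l (ltW (divr_gt0 h0 (ltr0Sn _ 1))) lhs; lra.
rewrite ler_pM2l// => main.
have : 0 <= (`|w'| - `|w|) * h * `|w'|.
  by rewrite !mulr_ge0// ?subr_ge0 ltW.
lra.
Qed.

Section Trajectory.
Variables x w : R -> H.
Hypothesis x_derivable :
  forall t : R, 0 <= t -> derivable_within (@half_line R) x t.
Hypothesis x_velocity :
  forall t : R, 0 <= t -> derive_within (@half_line R) x t = - w t.

Lemma trajectory_right_expansion (t e : R) : 0 <= t -> 0 < e ->
  \forall s \near t^'+, `|x s - x t + (s - t) *: w t| <= e * (s - t).
Proof.
move=> t0 e0; have := derivable_within_expansion (x_derivable t0) e0.
rewrite x_velocity// => exp.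
apply: filterS exp => s hs ts.
have := hs; rewrite /half_line /= in_itv /= andbT scalerN opprK.
by rewrite gtr0_norm ?subr_gt0//; apply; rewrite (le_trans t0)// ltW.
Qed.

Lemma trajectory_right_near (t d : R) : 0 < d ->
  \forall s \near t^'+, 0 < s - t <= d.
Proof.
move=> d0; near=> s; apply/andP; split.
  by rewrite subr_gt0; near: s; exact: nbhs_right_gt.
by rewrite lerBlDl; near: s; apply: nbhs_right_le; rewrite ltrDl.
Unshelve. all: by end_near. Qed.

Lemma trajectory_continuous (a b : R) : 0 <= a -> {within `[a, b], continuous x}.
Proof.
move=> a0; apply: (@continuous_subspaceW _ _ _ (@half_line R)).
  move=> t; rewrite /half_line /= !in_itv /= andbT => /andP[at_ _].
  exact: le_trans at_.
apply/subspace_continuousP => t; rewrite /half_line /= in_itv /= andbT => t0.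
exact: derivable_within_continuous (x_derivable t0).
Qed.

Lemma norm_velocity_nonincreasing (a b : R) :
  (forall s t : R, 0 <= s -> 0 <= t ->
     0 <= dot ((x t - w t) - (x s - w s)) (cube_diff (w s) (w t))) ->
  (forall t : R, 0 <= t -> w t != 0) ->
  0 <= a -> a <= b -> `|w b| <= `|w a|.
Proof.
move=> mon w0 a0 ab; apply: (@dini_nonincreasing (fun t => `|w t|)) => //.
  have /subspace_continuousP xcont := @trajectory_continuous a b a0.
  apply/subspace_continuousP => t tab; apply/cvgrPdist_le => e e0.
  have e2 : 0 < e / 2 by rewrite divr_gt0.
  have /cvgrPdist_le/(_ _ e2) := xcont t tab.
  move=> near_t; near=> s.
  have sab : s \in `[a, b] by near: s; exact: withinT.
  have : `|x t - x s| <= e / 2 by near: s.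
  move: tab sab; rewrite /= !in_itv /= => /andP[at_ _] /andP[as_ _] xs.
  rewrite (le_trans (ler_dist_dist _ _))//.
  apply: le_trans (yosida_lipschitz (mon s t _ _)) _; rewrite ?(le_trans a0)//.
  by lra.
move=> t /andP[at_ tb] e e0.
have t0 : 0 <= t by rewrite (le_trans a0).
have wt : 0 < `|w t| by rewrite normr_gt0 w0.
set c := `|w t| in wt *.
(* with a remainder at most eta h and a step at most d, the bound of
   norm_velocity_step is below e h times h c *)
pose eta := Num.min 1 (e * c / (16 * (c + 1))).
pose d := e * c / (16 * (c + 1) ^+ 2).
have c1 : 0 < c + 1 by lra.
have eta0 : 0 < eta by rewrite lt_min ltr01 divr_gt0 ?mulr_gt0.
have d0 : 0 < d by rewrite divr_gt0 ?mulr_gt0 ?exprn_gt0.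
have eta1 : eta <= 1 by rewrite ge_min lexx.
have eta_le : 16 * (c + 1) * eta <= e * c.
  by rewrite mulrC -ler_pdivlMr ?mulr_gt0// ge_min lexx orbT.
have d_le : 16 * (c + 1) ^+ 2 * d = e * c.
  by rewrite mulrC mulfVK// lt0r_neq0// mulr_gt0 ?exprn_gt0.
near=> s.
have /andP[h0 hd] : 0 < s - t <= d by near: s; exact: trajectory_right_near.
have r_le : `|x s - x t + (s - t) *: w t| <= eta * (s - t).
  by near: s; exact: trajectory_right_expansion.
have s0 : 0 <= s by lra.
have step := norm_velocity_step h0 (w0 _ t0) (mon _ _ t0 s0).
have D_le : `|x s - x t| <= (c + 1) * (s - t).
  rewrite -[x s - x t](addrK ((s - t) *: w t)) (le_trans (ler_normB _ _))//.
  rewrite normrZ gtr0_norm// -/c; nra.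
rewrite -/c in step.
move: (`|w s|) (`|x s - x t|) (normr_ge0 (x s - x t)) D_le step => c' D D0 D_le.
move: (`|_|) (normr_ge0 (x s - x t + (s - t) *: w t)) r_le => r r0 r_le.
move: (s - t) h0 hd D_le r_le => h h0 hd D_le r_le step.
have bound : 4 * (r + h * D) * (2 * D) <= e * h * h * c.
  have f1 : 4 * (r + h * D) <= 4 * h * (eta + d * (c + 1)).
    rewrite -subr_ge0; have : 0 <= h * (d - h) * (c + 1).
      by rewrite !mulr_ge0 ?subr_ge0// ltW.
    have : 0 <= h * ((c + 1) * h - D) by rewrite mulr_ge0 ?subr_ge0// ltW.
    by lra.
  have f2 : 2 * D <= 2 * (c + 1) * h by lra.
  have f3 : 0 <= 4 * (r + h * D) by rewrite mulr_ge0// addr_ge0// mulr_ge0// ltW.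
  apply: le_trans (ler_pM f3 (mulr_ge0 (ler0n _ 2) D0) f1 f2) _.
  have : 0 <= h * h * (e * c - 16 * (c + 1) * eta).
    by rewrite !mulr_ge0 ?subr_ge0// ltW.
  have : h * h * (16 * (c + 1) ^+ 2 * d) = h * h * (e * c) by rewrite d_le.
  by lra.
have := le_trans step bound.
rewrite (_ : (c' - c) * h * c = (c' - c) * (h * c)); last by rewrite mulrA.
rewrite (_ : e * h * h * c = e * h * (h * c)); last by rewrite !mulrA.
by rewrite ler_pM2r ?mulr_gt0.
Unshelve. all: by end_near. Qed.

(** The energy |x - z|^2 has derivative - 2 <w, x - z>. *)
Lemma trajectory_energy_decay (a b k : R) z : 0 <= a -> a <= b ->
  (forall t, a <= t < b -> k <= dot (w t) (x t - z)) ->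
  `|x b - z| ^+ 2 + 2 * k * (b - a) <= `|x a - z| ^+ 2.
Proof.
move=> a0 ab kw.
suff : `|x b - z| ^+ 2 + 2 * k * b <= `|x a - z| ^+ 2 + 2 * k * a by lra.
apply: (@dini_nonincreasing (fun t => `|x t - z| ^+ 2 + 2 * k * t)) => //.
  have /subspace_continuousP xcont := @trajectory_continuous a b a0.
  apply/subspace_continuousP => t tab; apply: cvgD.
    have dist_cvg : `|x s - z| @[s --> within `[a, b] (nbhs t)] --> `|x t - z|.
      by apply: cvg_norm; apply: cvgB; [exact: xcont|exact: cvg_cst].
    by apply: cvgM.
  by apply: cvgMr; apply: cvg_within.
move=> t tab e e0.
have t0 : 0 <= t by case/andP: tab => at_ _; rewrite (le_trans a0).
pose N := `|x t - z|; pose M := (`|w t| + 1) ^+ 2.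
(* eta absorbs the remainder of the expansion, d the quadratic term *)
pose eta := Num.min 1 (e / (4 * (N + 1))).
pose d := e / (2 * M).
have N0 : 0 <= N by exact: normr_ge0.
have M0 : 0 < M by rewrite exprn_gt0// ltr_wpDl.
have eta0 : 0 < eta by rewrite lt_min ltr01 divr_gt0 ?mulr_gt0// ltr_wpDl.
have d0 : 0 < d by rewrite divr_gt0 ?mulr_gt0.
have eta1 : eta <= 1 by rewrite ge_min lexx.
have eta_le : 4 * (N + 1) * eta <= e.
  by rewrite mulrC -ler_pdivlMr ?mulr_gt0 ?ltr_wpDl// ge_min lexx orbT.
have d_le : 2 * M * d = e by rewrite mulrC mulfVK// lt0r_neq0// mulr_gt0.
near=> s.
have /andP[h0 hd] : 0 < s - t <= d by near: s; exact: trajectory_right_near.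
have r_le : `|x s - x t + (s - t) *: w t| <= eta * (s - t).
  by near: s; exact: trajectory_right_expansion.
have D_le : `|x s - x t| <= (`|w t| + 1) * (s - t).
  rewrite -[x s - x t](addrK ((s - t) *: w t)) (le_trans (ler_normB _ _))//.
  rewrite normrZ gtr0_norm//; nra.
have D2_le : `|x s - x t| ^+ 2 <= M * (s - t) ^+ 2.
  have M1 : 0 <= (`|w t| + 1) * (s - t).
    by apply: mulr_ge0; [rewrite addr_ge0|exact: ltW].
  by rewrite -exprMn lerXn2r ?nnegrE.
have cs := dot_le_norm (x s - x t + (s - t) *: w t) (x t - z).
have := kw _ tab.
have -> : `|x s - z| ^+ 2 = `|x t - z| ^+ 2 + 2 * dot (x s - x t) (x t - z)
    + `|x s - x t| ^+ 2.
  rewrite -!dot_norm !dotE (dotC z) !(dotC (x t)); ring.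
move: cs; rewrite dotDl dotZl -/N => cs kle.
have f1 : `|x s - x t + (s - t) *: w t| * N <= eta * (s - t) * N.
  by rewrite ler_wpM2r.
have f2 : (s - t) * k <= (s - t) * dot (w t) (x t - z) by rewrite ler_pM2l.
have f3 : M * (s - t) ^+ 2 <= M * d * (s - t).
  by rewrite expr2 mulrA ler_pM2r// ler_pM2l.
have f4 : 2 * eta * N <= e / 2 by nra.
have f5 : 2 * eta * N * (s - t) <= e / 2 * (s - t) by rewrite ler_pM2r.
have f6 : 2 * M * d * (s - t) = e * (s - t) by rewrite d_le.
lra.
Unshelve. all: by end_near. Qed.

End Trajectory.

(** * Weak limits along ultrafilters *)

(** If F misses the preimage of a neighbourhood, it can be refined by the
    complement, and an ultrafilter above the refinement contradicts the
    hypothesis. *)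
Lemma cvg_along_ultrafilters (T : Type) (V : topologicalType)
    (F : set_system T) (FF : ProperFilter F) (f : T -> V) (l : V) :
  (forall U, UltraFilter U -> F `<=` U -> f @ U --> l) -> f @ F --> l.
Proof.
move=> ultra N Nl; apply: contrapT => nFN.
have GF : ProperFilter (within (~` (f @^-1` N)) F).
  split=> [F0|]; last exact: within_filter.
  apply: nFN; change (F (f @^-1` N)).
  have {}F0 : F [set t | (~` (f @^-1` N)) t -> False] by exact: F0.
  by apply: filterS F0 => t; exact: contrapT.
have [U [UU GU]] := ultraFilterLemma GF.
have FU : F `<=` U by move=> P FP; apply: GU; apply: filterS FP => t Pt _.
have UN : U (f @^-1` N) by exact: ultra U UU FU N Nl.
have UnN : U (~` (f @^-1` N)) by apply: GU; exact: withinT.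
by have [t [Nt nNt]] := filter_ex (filterI UN UnN).
Qed.

Lemma ultra_bounded_cvg (T : Type) (U : set_system T) (UU : UltraFilter U)
    (g : T -> R) (M : R) :
  (\forall t \near U, `|g t| <= M) -> cvg (g @ U).
Proof.
move=> gM.
have [|c [_ gc]] := @segment_compact R (- M) M (g @ U) _.
  by apply: filterS gM => t; rewrite /= in_itv /= ler_norml.
apply/cvg_ex; exists c => N Nc.
have [//|UnN] := in_ultra_setVsetC (g @^-1` N) UU.
have [r [/= nNr Nr]] := gc (~` N) N UnN Nc.
by [].
Qed.

(** Weak compactness of balls: the limits of t |-> <f t, y> exist for every y
    and form a bounded linear form in y. *)
Lemma weak_cvg_ultra (T : Type) (U : set_system T) (UU : UltraFilter U)
    (f : T -> H) (M : R) : (\forall t \near U, `|f t| <= M) ->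
  exists p, forall y, dot (f t) y @[t --> U] --> dot p y.
Proof.
move=> fM.
have bound y : \forall t \near U, `|dot (f t) y| <= M * `|y|.
  apply: filterS fM => t ftM; apply: le_trans (normr_dot_le _ _) _.
  exact: ler_wpM2r.
pose phi y : R := lim (dot (f t) y @[t --> U]).
have phi_cvg y : dot (f t) y @[t --> U] --> phi y.
  exact: ultra_bounded_cvg (bound y).
have [|||p phiE] := @riesz_representation phi M.
- move=> u v; apply: cvg_lim => //; under eq_fun do rewrite dotDr.
  exact: cvgD.
- move=> c u; apply: cvg_lim => //; under eq_fun do rewrite dotZr.
  exact: cvgMr.
- move=> u; apply: cvgr_to_le (phi_cvg u) _.
  by apply: filterS (bound u) => t; rewrite ler_norml => /andP[].
by exists p => y; rewrite -phiE.
Qed.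

(** Opial's lemma.  If p and q are weak limits along two ultrafilters, then
    2 <f, p - q> = |f - q|^2 - |f - p|^2 + |p|^2 - |q|^2 converges along F, so
    that <p, p - q> = <q, p - q>. *)
Lemma opial (T : Type) (F : set_system T) (FF : ProperFilter F) (f : T -> H)
    (S : set H) (M : R) :
  (\forall t \near F, `|f t| <= M) ->
  (forall z, S z -> cvg (`|f t - z| @[t --> F])) ->
  (forall U p, UltraFilter U -> F `<=` U ->
     (forall y, dot (f t) y @[t --> U] --> dot p y) -> S p) ->
  exists2 p, S p & forall y, dot (f t) y @[t --> F] --> dot p y.
Proof.
move=> fM S_cvg S_cluster.
have ultra_lim U : UltraFilter U -> F `<=` U ->
    exists2 p, S p & forall y, dot (f t) y @[t --> U] --> dot p y.
  move=> UU FU; have [|p fp] := @weak_cvg_ultra _ U UU f M; first exact: FU.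
  by exists p => //; exact: S_cluster fp.
have [U [UU FU]] := ultraFilterLemma FF.
have [p Sp fp] := ultra_lim U UU FU.
exists p => // y; apply: cvg_along_ultrafilters => V VV FV.
have [q Sq fq] := ultra_lim V VV FV.
suff -> : p = q by exact: fq.
have [l fl] : exists l : R, dot (f t) (p - q) @[t --> F] --> l.
  pose l z := lim (`|f t - z| @[t --> F]).
  have sqr_cvg z : S z -> `|f t - z| ^+ 2 @[t --> F] --> l z ^+ 2.
    by move=> Sz; apply: cvgM; exact: S_cvg.
  exists ((l q ^+ 2 - l p ^+ 2 + (`|p| ^+ 2 - `|q| ^+ 2)) / 2).
  rewrite (_ : (fun t => _) = fun t =>
      (`|f t - q| ^+ 2 - `|f t - p| ^+ 2 + (`|p| ^+ 2 - `|q| ^+ 2)) / 2).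
    apply: cvgMl; apply: cvgD; last exact: cvg_cst.
    by apply: cvgB; exact: sqr_cvg.
  apply/funext => t; rewrite -!dot_norm !dotE (dotC p (f t)) (dotC q (f t)).
  by field.
have pl : dot p (p - q) = l.
  have flU : dot (f t) (p - q) @[t --> U] --> l by move=> N /fl; exact: FU.
  by rewrite -(cvg_lim _ (fp (p - q)))// (cvg_lim _ flU).
have ql : dot q (p - q) = l.
  have flV : dot (f t) (p - q) @[t --> V] --> l by move=> N /fl; exact: FV.
  by rewrite -(cvg_lim _ (fq (p - q)))// (cvg_lim _ flV).
have : dot (p - q) (p - q) = 0 by rewrite dotDl dotNl pl ql subrr.
by rewrite dot_norm => /eqP; rewrite sqrf_eq0 normr_eq0 subr_eq0 => /eqP.
Qed.

(** * The closed-loop flow *)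

Lemma resolvent_graph (A : H -> set H) (l : R) u :
  maximal_monotone dot A -> 0 < l ->
  A (resolvent A l u) (l^-1 *: (u - resolvent A l u)).
Proof.
move=> maxA l0.
have [v Av uE] : inverse_op (id_plus_scale l A) u (resolvent A l u).
  apply: getPex; have [y Ay] := minty u maxA l0.
  exists y, (l^-1 *: (u - y)) => //.
  by rewrite scalerA divff ?lt0r_neq0// scale1r addrCA subrr addr0.
suff -> : l^-1 *: (u - resolvent A l u) = v by [].
by rewrite -[X in X - _]uE addrAC subrr add0r scalerA mulVf ?lt0r_neq0// scale1r.
Qed.

Section ClosedLoopFlow.
Variables (A : H -> set H) (theta : R) (x w : R -> H).
Hypothesis maxA : maximal_monotone dot A.
Hypothesis theta_gt0 : 0 < theta.
Hypothesis x_derivable :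
  forall t : R, 0 <= t -> derivable_within (@half_line R) x t.
Hypothesis x_velocity :
  forall t : R, 0 <= t -> derive_within (@half_line R) x t = - w t.
Hypothesis w_neq0 : forall t : R, 0 <= t -> w t != 0.
Hypothesis w_graph : forall t : R, 0 <= t ->
  A (x t - w t) (theta^-1 *: (`|w t| *: w t)).

Let normw_gt0 (t : R) : 0 <= t -> 0 < `|w t|.
Proof. by move=> t0; rewrite normr_gt0 w_neq0. Qed.

Lemma flow_speed_nonincreasing (s t : R) : 0 <= s -> s <= t -> `|w t| <= `|w s|.
Proof.
move=> s0 st; apply: (norm_velocity_nonincreasing x_derivable x_velocity) => //.
move=> a b a0 b0; have := maxA.1 _ _ _ _ (w_graph b0) (w_graph a0).
by rewrite -scalerBr dotZr pmulr_rge0 ?invr_gt0.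
Qed.

(** Monotonicity between the point x - w of the graph and the zero z. *)
Lemma flow_speed_le_dot (t : R) z : 0 <= t -> zeros A z ->
  `|w t| ^+ 2 <= dot (w t) (x t - z).
Proof.
move=> t0 Az; have := maxA.1 _ _ _ _ (w_graph t0) Az.
rewrite subr0 !dotZr !pmulr_rge0 ?invr_gt0 ?normw_gt0//.
by rewrite addrAC dotDl dotNl dot_norm dotC subr_ge0.
Qed.

(** On [s, t] the decay rate 2 |w|^2 of the squared distance is at least its
    final value, since the speed is nonincreasing. *)
Lemma flow_dist_decay (s t : R) z : 0 <= s -> s <= t -> zeros A z ->
  `|x t - z| ^+ 2 + 2 * `|w t| ^+ 2 * (t - s) <= `|x s - z| ^+ 2.
Proof.
move=> s0 st Az.
apply: (trajectory_energy_decay x_derivable x_velocity) => // r /andP[sr rt].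
have r0 : 0 <= r by rewrite (le_trans s0).
apply: le_trans (flow_speed_le_dot r0 Az).
by rewrite lerXn2r ?nnegrE// flow_speed_nonincreasing// ltW.
Qed.

Lemma flow_dist_decreasing (s t : R) z : 0 <= s -> s < t -> zeros A z ->
  `|x t - z| < `|x s - z|.
Proof.
move=> s0 st Az; have t0 : 0 <= t by rewrite (le_trans s0) ?ltW.
rewrite -(@ltr_pXn2r _ 2) ?nnegrE//.
apply: lt_le_trans (flow_dist_decay s0 (ltW st) Az).
by rewrite ltrDl !mulr_gt0 ?subr_gt0 ?exprn_gt0 ?normw_gt0.
Qed.

Lemma flow_speed_bound (t : R) z : 0 <= t -> zeros A z ->
  Num.sqrt (2 * t) * `|w t| <= `|x 0 - z|.
Proof.
move=> t0 Az; rewrite -(@ler_pXn2r _ 2) ?nnegrE ?mulr_ge0 ?sqrtr_ge0//.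
rewrite exprMn sqr_sqrtr ?mulr_ge0//.
have := flow_dist_decay (lexx 0) t0 Az; rewrite subr0.
by have := sqr_ge0 (`|x t - z|); lra.
Qed.

Lemma flow_speed_cvg0 : zeros A !=set0 -> `|w t| @[t --> +oo] --> (0 : R).
Proof.
move=> [z Az]; apply/cvgr0Pnorm_le => e e0.
pose N := `|x 0 - z|.
near=> t; rewrite normr_id.
have t0 : 0 < t by near: t; exact: nbhs_pinfty_gt.
have tN : N ^+ 2 / (2 * e ^+ 2) <= t
  by near: t; apply: nbhs_pinfty_ge; exact: num_real.
have h : N <= Num.sqrt (2 * t) * e.
  have t_ge0 := ltW t0; have e_ge0 := ltW e0.
  rewrite -(@ler_pXn2r _ 2) ?nnegrE ?normr_ge0 ?mulr_ge0 ?sqrtr_ge0//.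
  rewrite exprMn sqr_sqrtr ?mulr_ge0//.
  by move: tN; rewrite ler_pdivrMr ?mulr_gt0 ?exprn_gt0//; lra.
rewrite -(@ler_pM2l _ (Num.sqrt (2 * t))) ?sqrtr_gt0 ?mulr_gt0//.
exact: le_trans (flow_speed_bound (ltW t0) Az) h.
Unshelve. all: by end_near. Qed.

Lemma flow_dist_cvg z : zeros A z -> cvg (`|x t - z| @[t --> +oo]).
Proof.
move=> Az.
(* freezing x at negative times makes the distance monotone on all of R *)
pose g t := - `|x (Num.max t 0) - z|.
have g_nondec : {homo g : s t / s <= t >-> s <= t}.
  move=> s t st; rewrite /g lerN2.
  have [->//|neq] := eqVneq (Num.max s 0) (Num.max t 0).
  apply/ltW/flow_dist_decreasing => //; first by rewrite le_max lexx orbT.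
  by rewrite lt_neqAle neq ge_max !le_max st lexx !orbT.
have g_bounded : has_ubound (range g).
  by exists 0 => _ [t _ <-]; rewrite oppr_le0.
apply/cvg_ex; exists (- sup (range g)).
apply: cvg_trans (cvgN (nondecreasing_cvgr g_nondec g_bounded)).
apply: near_eq_cvg; near=> t; have t0 : 0 <= t by near: t; exact: nbhs_pinfty_ge.
by rewrite /g /= opprK max_l.
Unshelve. all: by end_near. Qed.

Lemma flow_norm_le z (t : R) : 0 <= t -> zeros A z ->
  `|x t| <= `|x 0 - z| + `|z|.
Proof.
move=> t0 Az; rewrite -[x t](subrK z) (le_trans (ler_normD _ _))// lerD2r.
have [->//|tn0] := eqVneq t 0.
by apply/ltW/flow_dist_decreasing; rewrite // lt_neqAle eq_sym tn0.
Qed.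

Lemma flow_weak_cvg : zeros A !=set0 ->
  exists2 p, zeros A p & forall y, dot (x t) y @[t --> +oo] --> dot p y.
Proof.
move=> [z Az]; pose M := `|x 0 - z| + `|z|.
have near_ge0 : \forall t \near +oo, 0 <= t :> R by exact: nbhs_pinfty_ge.
apply: (@opial _ _ _ x (zeros A) M).
- by apply: filterS near_ge0 => t t0; exact: flow_norm_le.
- exact: flow_dist_cvg.
move=> U p UU FU xp; change (A p 0).
apply: maximal_monotone_related => // u v Auv.
have w_cvg0 : `|w t| @[t --> U] --> (0 : R).
  by move=> N /(flow_speed_cvg0 (ex_intro _ z Az)); exact: FU.
pose K := M + `|u|.
pose err (c : R) := theta^-1 * (c * (K * c)) + c * `|v|.
(* monotonicity between x - w and u, whose second component tends to 0 *)
have main t : 0 <= t -> dot (x t) v <= dot u v + err `|w t|.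
  move=> t0; have := maxA.1 _ _ _ _ (w_graph t0) Auv.
  set a := `|w t|; set y := x t - u.
  have xu : `|y| <= K.
    by rewrite (le_trans (ler_normB _ _))// lerD2r flow_norm_le.
  have -> : x t - w t - u = y - w t by rewrite addrAC.
  have -> : dot (x t) v = dot u v + dot y v by rewrite /y dotDl dotNl subrKC.
  rewrite lerD2l; move: y xu => y yK mon.
  have cs : dot y (w t) <= K * a.
    by apply: le_trans (dot_le_norm _ _) _; rewrite ler_wpM2r.
  have cs' : theta^-1 * (a * dot y (w t)) <= theta^-1 * (a * (K * a)).
    by rewrite ler_pM2l ?invr_gt0// ler_wpM2l ?normr_ge0.
  have wv := dot_le_norm (w t) v; rewrite -/a in wv.
  have : 0 <= theta^-1 * (a * dot (w t) (w t)).
    by rewrite !mulr_ge0 ?dot_ge0 ?invr_ge0 ?normr_ge0// ltW.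
  by move: mon; rewrite /err !dotE; lra.
have err_cvg : dot u v + err `|w t| @[t --> U] --> dot u v.
  rewrite -[X in _ --> X]addr0; apply: cvgD; first exact: cvg_cst.
  rewrite -[X in _ --> X]addr0 -[X in _ --> X + _](mulr0 theta^-1).
  rewrite -[X in _ --> _ + X](mul0r `|v|).
  apply: cvgD; last exact: cvgMl.
  apply: cvgMr; rewrite -[X in _ --> X](mul0r (K * 0)).
  by apply: cvgM => //; exact: cvgMr.
rewrite sub0r dotNr oppr_ge0 dotDl dotNl subr_le0.
apply: ler_cvg_to (xp v) err_cvg _.
by apply: FU; apply: filterS near_ge0 => t; exact: main.
Qed.

End ClosedLoopFlow.

End InnerProduct.

Theorem theorem3p2 (R : realType) (H : completeNormedModType R)
    (dot : {dot H for idfun}) (dot_norm : induces_norm dot)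
    (A : H -> set H) (maxA : maximal_monotone dot A)
    (theta : R) (theta_gt0 : 0 < theta) (zerosA : zeros A !=set0)
    (x0 : H) (x0_notin : ~ zeros A x0)
    (x : R -> H) (lambda : R -> R)
    (sol : global_solution A theta x0 x lambda) :
  let xdot := derive_within (@half_line R) x in
  let d0 := dist x0 (zeros A) in
  [/\ (forall t : R, 0 < t ->
         `|xdot t| = `|x t - resolvent A (lambda t) (x t)| /\
         `|x t - resolvent A (lambda t) (x t)| <= d0 / Num.sqrt (2 * t)) /\
      `|xdot t| @[t --> +oo] --> (0 : R),
      (forall t : R, 0 < t -> theta * Num.sqrt (2 * t) / d0 <= lambda t) /\
      lambda t @[t --> +oo] --> +oo,
      exists2 xoo : H, zeros A xoo & weakly_cvg_pinfty dot x xoo &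
      forall z : H, zeros A z ->
        forall s t : R, 0 <= s -> s < t -> `|x t - z| < `|x s - z| ].
Proof.
move=> xdot d0.
have ip := dot_form_inner_product dot_norm.
have [[x_der _] _ ode lambda_gt0 constraint x_init] := sol.
pose w t := x t - resolvent A (lambda t) (x t).
have half (t : R) : 0 <= t -> half_line t.
  by move=> t0; rewrite /half_line /= in_itv /= andbT.
have x_derivable t : 0 <= t -> derivable_within (@half_line R) x t.
  by move=> /half; exact: x_der.
have x_velocity t : 0 <= t -> derive_within (@half_line R) x t = - w t.
  by move=> t0; apply/eqP; rewrite -addr_eq0 /w addrA; apply/eqP; exact: ode.
have lambda_w t : 0 <= t -> lambda t * `|w t| = theta.
  by move=> t0; rewrite /w distrC constraint.
have w_gt0 t : 0 <= t -> 0 < `|w t|.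
  by move=> t0; rewrite -(pmulr_rgt0 _ (lambda_gt0 t t0)) lambda_w.
have w_neq0 t : 0 <= t -> w t != 0 by move=> /w_gt0; rewrite normr_gt0.
have w_graph t : 0 <= t -> A (x t - w t) (theta^-1 *: (`|w t| *: w t)).
  move=> t0; have := resolvent_graph ip (x t) maxA (lambda_gt0 t t0).
  rewrite -/(w t) [x t - w t]subKr -(lambda_w t t0) scalerA invfM.
  by rewrite mulfVK// lt0r_neq0// w_gt0.
have speed_bound t : 0 < t -> Num.sqrt (2 * t) * `|w t| <= d0.
  move=> t0; apply: lb_le_inf.
    by have [z Az] := zerosA; exists `|x0 - z|, z.
  move=> _ [z Az <-]; rewrite -x_init.
  exact: (flow_speed_bound ip maxA theta_gt0 x_derivable x_velocity w_neq0
    w_graph (ltW t0) Az).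
have speed_cvg0 := flow_speed_cvg0 ip maxA theta_gt0 x_derivable x_velocity
  w_neq0 w_graph zerosA.
have near_ge0 : \forall t \near +oo, 0 <= t :> R by exact: nbhs_pinfty_ge.
have sqrt_gt0 (t : R) : 0 < t -> 0 < Num.sqrt (2 * t).
  by move=> t0; rewrite sqrtr_gt0 mulr_gt0.
split.
- split=> [t t0|].
    split; first by rewrite /xdot x_velocity ?normrN// ltW.
    by rewrite ler_pdivlMr ?sqrt_gt0// mulrC; exact: speed_bound.
  apply: cvg_trans speed_cvg0; apply: near_eq_cvg.
  by apply: filterS near_ge0 => t t0; rewrite /xdot x_velocity// normrN.
- split=> [t t0|].
    have t_ge0 := ltW t0.
    have d0_gt0 : 0 < d0.
      by apply: lt_le_trans (speed_bound t t0); rewrite mulr_gt0 ?sqrt_gt0 ?w_gt0.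
    rewrite ler_pdivrMr// -(lambda_w t t_ge0) -mulrA ler_pM2l ?lambda_gt0//.
    by rewrite mulrC speed_bound.
  apply/cvgryPge => B; have B1 : 0 < `|B| + 1 by rewrite ltr_wpDl.
  have near_le : \forall t \near +oo, `| `|w t| | <= theta / (`|B| + 1).
    by apply: (cvgr0_norm_le _ speed_cvg0); exact: divr_gt0.
  apply: filterS2 near_ge0 near_le => t t0.
  rewrite normr_id => w_le.
  rewrite -(ler_pM2r (w_gt0 t t0)) lambda_w//.
  apply: (@le_trans _ _ ((`|B| + 1) * `|w t|)).
    by rewrite ler_wpM2r// (le_trans (ler_norm _))// lerDl.
  by rewrite mulrC -ler_pdivlMr.
- exact: (flow_weak_cvg ip maxA theta_gt0 x_derivable x_velocity w_neq0
    w_graph zerosA).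
- move=> z Az s t s0 st.
  exact: (flow_dist_decreasing ip maxA theta_gt0 x_derivable x_velocity w_neq0
    w_graph s0 st Az).
Qed.
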